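(* Let $\Omega=(0,1)$, $f\in L^1(\Omega)$, and let $u\in H^1_0(\Omega)$ be a solution of $\int_0^1u'v'\,dx=\int_0^1fv\,dx$ for all $v\in H^1_0(\Omega)$. For $s\in(0,1)$ write $\Gamma_t(x)=-\frac{|x-t|}{2}$ and let $$\phi_s(x)=2\left(\Gamma_s(x)-\frac{\Gamma_s(x)-\Gamma_{-s}(x)}{\Gamma_s(1)-\Gamma_{-s}(1)}\Gamma_s(1)-\frac{\Gamma_s(x)-\Gamma_{2-s}(x)}{\Gamma_s(0)-\Gamma_{2-s}(0)}\Gamma_s(0)\right),$$ which is a test function with coefficient $a_s=\frac1{s(1-s)}$ of $\Gamma_s$. Then $u$ is globally Green-representable with respect to the mapping $\Phi:s\mapsto\phi_s$, and for all $s\in\Omega$ $$a_s\,u(s)=\int_0^1f(x)\phi_s(x)\,dx.$$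
   Context: Test functions in dimension one: for $s\in\Omega=(0,1)$, a test function is $\phi_s(x)=a_s\Gamma_s(x)+H_s(x)$ with $a_s\ne0$ real and $H_s$ of class $C^2$ with $H_s''=0$ in some open set $U\supset[0,1]$. Globally Green-representable with respect to a mapping $\Phi:s\mapsto\phi_s$ (assigning to each $s\in\Omega$ a test function with coefficient $a_s$) means: $u\in W^{1,q}(\Omega)$ for some $q>1$, and for every $s\in\Omega$ $$a_su(s)=\int_0^1f\phi_s\,dx+\Big\langle\frac{\partial u}{\partial n},\phi_s|_{\partial\Omega}\Big\rangle,$$ where the weak Neumann trace is defined by $\langle\frac{\partial u}{\partial n},\psi\rangle:=\int_0^1u'v'\,dx-\int_0^1fv\,dx$ for any boundary data $\psi$ on $\{0,1\}$ and any $v\in H^1(\Omega)$ with $v=\psi$ on $\{0,1\}$. Functions in $H^1(0,1)$ are identified with their continuous representatives. *)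

(* Defs.v *)
From HB Require Import structures.
From mathcomp Require Import all_boot all_order all_algebra.
From mathcomp Require Import all_classical all_reals all_analysis.

Set Implicit Arguments.
Unset Strict Implicit.
Unset Printing Implicit Defensive.

Import Order.TTheory GRing.Theory Num.Theory.
Import numFieldNormedType.Exports.

Local Open Scope classical_set_scope.
Local Open Scope ring_scope.

(* Functions on Omega = (0,1) are total functions R -> R; only their values on
   [0,1] (or on the open set under consideration) are ever used. *)

Definition Omega (R : realType) : set R := [set` `]0, 1[].
Arguments Omega {R}.

Definition bOmega (R : realType) : set R := [set 0; 1].
Arguments bOmega {R}.

(* Real-valued Lebesgue integral over Omega, meaningful for integrable f. *)
Definition intO (R : realType) (f : R -> R) : R :=
  \int[@lebesgue_measure R]_(x in Omega) f x.

(* L^q(0,1): [f \_ Omega] is f extended by 0 outside Omega. *)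
Definition Lq (R : realType) (q : R) (f : R -> R) : Prop :=
  (f \_ Omega : measurableTypeR R -> R) \in Lfun (@lebesgue_measure R) q%:E.

(* C_c^infty(0,1) *)
Definition Cc_infty (R : realType) (eta : R -> R) : Prop :=
  (forall (n : nat) (x : R), derivable (derive1n n eta) x 1) /\
  (let supp := closure [set x | eta x != 0] in
   compact supp /\ supp `<=` Omega).

Definition weak_derivative (R : realType) (u g : R -> R) : Prop :=
  [/\ locally_integrable Omega u, locally_integrable Omega g &
      forall eta : R -> R, Cc_infty eta ->
        intO (fun x => u x * derive1 eta x) = - intO (fun x => g x * eta x)].

(* The weak derivative u', unique up to a null set, as a chosen
   representative; it is 0 if u has no weak derivative. *)
Definition wderiv (R : realType) (u : R -> R) : R -> R :=
  xget (fun=> 0) [set g | weak_derivative u g].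

(* W^{1,q}(0,1), every class being identified with its continuous
   representative on [0,1], so that point and boundary values make sense. *)
Definition W1q (R : realType) (q : R) (u : R -> R) : Prop :=
  [/\ {within `[0, 1], continuous u}, Lq q u &
      exists2 g : R -> R, weak_derivative u g & Lq q g].

Definition H1 (R : realType) (u : R -> R) : Prop := W1q 2 u.

Definition H1norm (R : realType) (u : R -> R) : R :=
  Num.sqrt (intO (fun x => u x ^+ 2) + intO (fun x => wderiv u x ^+ 2)).

(* H^1_0(0,1): the closure of C_c^infty(0,1) in H^1(0,1). *)
Definition H10 (R : realType) (u : R -> R) : Prop :=
  H1 u /\
  forall e : R, 0 < e -> exists2 eta : R -> R, Cc_infty eta &
    H1norm (u \- eta) < e.

(* -u'' = f weakly, with u = 0 on the boundary. *)
Definition weak_dirichlet_solution (R : realType) (f u : R -> R) : Prop :=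
  H10 u /\
  forall v : R -> R, H10 v ->
    intO (fun x => wderiv u x * wderiv v x) = intO (fun x => f x * v x).

Definition Gamma (R : realType) (t x : R) : R := - (`|x - t| / 2).

Definition test_function (R : realType) (s a : R) (phi : R -> R) : Prop :=
  a != 0 /\
  exists H : R -> R, (forall x, phi x = a * Gamma s x + H x) /\
  exists U : set R,
    [/\ open U, [set` `[0, 1]] `<=` U,
        (forall x, U x ->
           [/\ derivable H x 1, derivable (derive1 H) x 1 &
               {for x, continuous (derive1n 2 H)}]) &
        forall x, U x -> (derive1n 2 H) x = 0].

Definition test_mapping (R : realType) (a : R -> R) (Phi : R -> R -> R) : Prop :=
  forall s : R, Omega s -> test_function s (a s) (Phi s).

(* [N] is the weak Neumann trace psi |-> <du/dn, psi>: the defining formula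
   holds for every extension v in H^1 of the boundary data psi, so that the
   existence of N includes the independence of the choice of v.  The data psi
   are given as functions on R, of which only psi 0 and psi 1 matter. *)
Definition weak_neumann_trace (R : realType) (f u : R -> R)
    (N : (R -> R) -> R) : Prop :=
  forall psi v : R -> R, H1 v -> (forall x, bOmega x -> v x = psi x) ->
    N psi = intO (fun x => wderiv u x * wderiv v x) - intO (fun x => f x * v x).

Definition globally_green_representable (R : realType) (f u : R -> R)
    (a : R -> R) (Phi : R -> R -> R) : Prop :=
  [/\ test_mapping a Phi,
      exists2 q : R, 1 < q & W1q q u &
      exists2 N : (R -> R) -> R, weak_neumann_trace f u N &
        forall s : R, Omega s ->
          a s * u s = intO (fun x => f x * Phi s x) + N (Phi s)].

Definition acoef (R : realType) (s : R) : R := 1 / (s * (1 - s)).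

Definition phi (R : realType) (s x : R) : R :=
  2 * (Gamma s x
       - (Gamma s x - Gamma (- s) x) / (Gamma s 1 - Gamma (- s) 1) * Gamma s 1
       - (Gamma s x - Gamma (2 - s) x) / (Gamma s 0 - Gamma (2 - s) 0)
         * Gamma s 0).

(* Main.v *)
Require Import Defs.
From mathcomp Require Import all_boot all_order all_algebra.
From mathcomp Require Import all_classical all_reals all_analysis.
From mathcomp Require Import measurable_realfun ring lra.
Set Implicit Arguments.
Unset Strict Implicit.
Import Order.TTheory GRing.Theory Num.Theory.
Import numFieldNormedType.Exports.
Local Open Scope classical_set_scope.
Local Open Scope ring_scope.

(** In dimension one the weak equation can be integrated explicitly, and every
claim then reduces to integration by parts.

Let F be the primitive of f that vanishes at 0.  Test functions belong to H^1_0,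
so the weak equation, integrated by parts against a test function eta, reads
[int (u' + F) eta' = 0].  By the lemma of du Bois-Reymond ([du_bois_reymond]),
u' = c - F almost everywhere for some constant c ([dirichlet_derivative]).
An H^1 function is the primitive of its weak derivative on the closed interval
([H1_prim]), hence for every v in H^1
[int u' v' - int f v = (c - F 1) v 1 - c v 0] ([dirichlet_green]).  The right-hand
side depends on v only through its boundary values, which is exactly the
existence of the weak Neumann trace.

Elements of H^1_0 vanish at both endpoints ([H10_boundary]), because point
evaluation is controlled by the H^1 norm.  So u(x) = c x - int_0^x F with
c = int_0^1 F.  On [0, 1] the function phi_s is the hat function
x |-> a_s min(x, s) - x / (1 - s) ([phi_hat]); it vanishes at 0 and 1, which kills
the boundary term, and integrating [int f phi_s] by parts gives
[1 / (1 - s) int_0^1 F - a_s int_0^s F] ([intO_phi]), which is a_s u(s).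

Three tools carry this.  Integration by parts for primitives of merely
integrable functions ([prim_by_parts]) is Fubini's theorem on the triangle x < y.
The fundamental lemma of the calculus of variations ([fundamental_lemma]) needs
only one explicit family of test functions, the bumps
exp (-1 / (k (x - a))) exp (-1 / (k (b - x))) on ]a, b[: as k grows they increase to
the indicator of ]a, b[, so a function orthogonal to them has zero integral over
every interval, and Lebesgue differentiation makes it null.  Du Bois-Reymond
follows, since a combination of two bumps with zero integral is the derivative of
a test function. *)

(** * Integration over the unit interval *)

Section Integrals.
Context {R : realType}.
Implicit Types f g h u v : R -> R.
Local Notation mu := (@lebesgue_measure R).

Definition integrableO f := mu.-integrable Omega (EFin \o f).

Lemma measurable_Omega : measurable (Omega : set R).
Proof. exact: measurable_itv. Qed.

Lemma open_Omega : open (Omega : set R).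
Proof. exact: interval_open. Qed.

Lemma measure_Omega : mu Omega = 1%:E.
Proof. by rewrite /Omega lebesgue_measure_itv/= lte_fin ltr01 -EFinD subr0. Qed.

Lemma Omega_sub01 : (Omega : set R) `<=` `[0, 1].
Proof. exact: subset_itv_oo_cc. Qed.

Lemma integrableO_measurable {f} : integrableO f -> measurable_fun Omega f.
Proof. by move=> /integrableP[/measurable_EFinP]. Qed.

Lemma integrableO_restrict {f} : integrableO f ->
  mu.-integrable setT (EFin \o (f \_ Omega)).
Proof.
by move=> fi; rewrite -restrict_EFin;
  exact: (@integrable_mkcond _ _ R mu Omega (EFin \o f) measurable_Omega).1.
Qed.

Lemma integrableOE f : integrableO f <-> mu.-integrable setT (EFin \o (f \_ Omega)).
Proof.
split; first exact: integrableO_restrict.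
rewrite -restrict_EFin => fi.
exact: (@integrable_mkcond _ _ R mu Omega (EFin \o f) measurable_Omega).2.
Qed.

Lemma eq_integrableO f g : (forall x, Omega x -> f x = g x) ->
  integrableO f -> integrableO g.
Proof.
move=> fg; apply: (@eq_integrable _ _ R mu Omega measurable_Omega) => x.
by rewrite inE => /fg /= ->.
Qed.

Lemma integrableOD f g : integrableO f -> integrableO g ->
  integrableO (fun x => f x + g x).
Proof. by move=> fi gi; exact: (@integrableD _ _ R mu Omega measurable_Omega _ _ fi gi). Qed.

Lemma integrableOB f g : integrableO f -> integrableO g ->
  integrableO (fun x => f x - g x).
Proof. by move=> fi gi; exact: (@integrableB _ _ R mu Omega measurable_Omega _ _ fi gi). Qed.

Lemma integrableOZ a f : integrableO f -> integrableO (fun x => a * f x).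
Proof. by move=> fi; exact: (@integrableZl _ _ R mu Omega measurable_Omega a _ fi). Qed.

Lemma integrableO_cst (a : R) : integrableO (fun=> a).
Proof.
apply: measurable_bounded_integrable; [exact: measurable_Omega| |by []|].
  by rewrite /= measure_Omega ltry.
by exists `|a|; split=> // M aM x _; exact: ltW.
Qed.

Lemma eq_intO f g : (forall x, Omega x -> f x = g x) -> intO f = intO g.
Proof. by move=> fg; apply: eq_Rintegral => x; rewrite inE => /fg. Qed.

Lemma intOD f g : integrableO f -> integrableO g ->
  intO (fun x => f x + g x) = intO f + intO g.
Proof. by move=> *; exact: (@RintegralD _ _ R mu Omega _ _ measurable_Omega). Qed.

Lemma intOB f g : integrableO f -> integrableO g ->
  intO (fun x => f x - g x) = intO f - intO g.
Proof. by move=> *; exact: (@RintegralB _ _ R mu Omega _ _ measurable_Omega). Qed.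

Lemma intOZ a f : integrableO f -> intO (fun x => a * f x) = a * intO f.
Proof. by move=> *; exact: (@RintegralZl _ _ R mu Omega _ _ measurable_Omega). Qed.

Lemma intO_cst (a : R) : intO (fun=> a) = a.
Proof.
rewrite /intO Rintegral_cst; last exact: measurable_Omega.
by rewrite [X in fine X]measure_Omega mulr1.
Qed.

Lemma le_intO f g : integrableO f -> integrableO g ->
  (forall x, Omega x -> f x <= g x) -> intO f <= intO g.
Proof. by move=> *; apply: (@le_Rintegral _ _ R mu Omega _ _ measurable_Omega). Qed.

Lemma ae_imply {P Q : R -> Prop} : (forall x, P x -> Q x) ->
  {ae mu, forall x, P x} -> {ae mu, forall x, Q x}.
Proof.
by move=> PQ; apply: filterS => //; exact: (ae_filter_ringOfSetsType mu).
Qed.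

(** Integrability is transported as well, because the chosen representative of a weak
derivative is only known up to a null set. *)
Lemma ae_eq_intO f g : integrableO f -> measurable_fun Omega g ->
  {ae mu, forall x, Omega x -> f x = g x} -> integrableO g /\ intO f = intO g.
Proof.
move=> fi mg fg; have mf := integrableO_measurable fi.
have E (F G : R -> \bar R) : measurable_fun Omega F -> measurable_fun Omega G ->
   {ae mu, forall x, Omega x -> F x = G x} ->
   (\int[mu]_(x in Omega) F x = \int[mu]_(x in Omega) G x)%E.
  by move=> *; apply: ae_eq_integral => //; exact: measurable_Omega.
split; last first.
  congr fine; apply: E; [exact/measurable_EFinP|exact/measurable_EFinP|].
  by apply: ae_imply fg => x /[apply] ->.
apply/integrableP; split; first exact/measurable_EFinP.
case/integrableP: fi => _; congr (_ < _)%E; apply: E.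
- by apply/measurableT_comp => //; exact/measurable_EFinP.
- by apply/measurableT_comp => //; exact/measurable_EFinP.
- by apply: ae_imply fg => x /[apply] /= ->.
Qed.

Lemma Lq1_integrableO f : Lq 1 f -> integrableO f.
Proof. by move=> /Lfun1_integrable fi; apply/integrableOE. Qed.

Lemma Lq2P f : Lq 2 f <->
  measurable_fun Omega f /\ integrableO (fun x => f x ^+ 2).
Proof.
have E : (fun x => f x ^+ 2) \_ Omega = (fun x => (f \_ Omega) x ^+ 2).
  by apply/funext => x; rewrite /patch; case: ifP => // _; rewrite expr0n.
split.
  move=> /[dup] f2 /Lfun2_integrable_sqr; rewrite integrableOE E; split=> //.
  apply: (@measurable_restrictT _ _ _ _ Omega f measurable_Omega).2.
  by move: f2; rewrite /Lq inE => /andP[]; rewrite inE.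
move=> [mf]; rewrite integrableOE E => fi.
rewrite /Lq inE; apply/andP; split; rewrite inE/=.
  exact: (@measurable_restrictT _ _ _ _ Omega f measurable_Omega).1.
rewrite /finite_norm unlock poweR_lty//.
move/integrable_lty : fi => /(_ measurableT).
apply: le_lt_trans; rewrite le_eqVlt; apply/orP; left; apply/eqP.
apply: eq_integral => x _; rewrite /=.
by rewrite powR_mulrn // -normrX ger0_norm// sqr_ge0.
Qed.

Lemma Lq2_integrableM f g : Lq 2 f -> Lq 2 g -> integrableO (fun x => f x * g x).
Proof.
move=> f2 g2; apply/integrableOE.
have := Lfun2_mul_Lfun1 f2 g2 => /Lfun1_integrable; congr (integrable _ _ _).
by apply/funext => x /=; rewrite /patch; case: ifP; rewrite ?mulr0.
Qed.

Lemma Lq2B f g : Lq 2 f -> Lq 2 g -> Lq 2 (fun x => f x - g x).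
Proof.
move=> /[dup] f2 /Lq2P[mf fi] /[dup] g2 /Lq2P[mg gi]; apply/Lq2P; split.
  exact: measurable_funB.
apply: (@eq_integrableO (fun x => f x ^+ 2 - 2 * (f x * g x) + g x ^+ 2)).
  by move=> x _; ring.
by apply: integrableOD => //; apply: integrableOB => //; apply: integrableOZ;
  exact: Lq2_integrableM.
Qed.

Lemma ae_eq_Lq2 f g : Lq 2 f -> measurable_fun Omega g ->
  {ae mu, forall x, Omega x -> f x = g x} -> Lq 2 g.
Proof.
move=> /Lq2P[mf fi] mg fg; apply/Lq2P; split=> //.
apply: (proj1 (@ae_eq_intO (fun x => f x ^+ 2) _ _ _ _)) => //.
  exact: measurable_funX.
by apply: ae_imply fg => x /[apply] ->.
Qed.

Lemma Lq2_cst (a : R) : Lq 2 (fun=> a).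
Proof. by apply/Lq2P; split => //; exact: integrableO_cst. Qed.

Lemma Lq2_integrableO f : Lq 2 f -> integrableO f.
Proof.
move=> f2; have := Lq2_integrableM f2 (Lq2_cst 1).
by apply: eq_integrableO => x _; rewrite mulr1.
Qed.

(** Continuity up to the endpoints: it gives boundedness, hence membership in every
L^q, and lets an almost everywhere identity determine the boundary values. *)
Definition continuous01 f := {within `[0, 1], continuous f}.

Lemma continuous01_bounded f : continuous01 f ->
  exists M, forall x, 0 <= x <= 1 -> `|f x| <= M.
Proof.
move=> cf; have := @segment_compact R 0 1.
move=> /(continuous_compact cf)/compact_bounded[M [_ Mf]].
exists (M + 1) => x x01; apply: (Mf (M + 1)); first by rewrite ltrDl.
by exists x => //=; rewrite in_itv.
Qed.

Lemma continuous01_measurable f : continuous01 f -> measurable_fun Omega f.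
Proof.
move=> cf; have m01 : measurable (`[0, 1]%classic : set R) by [].
by have := subspace_continuous_measurable_fun m01 cf; exact: (measurable_funS m01 Omega_sub01).
Qed.

Lemma bounded_integrableM f g M : measurable_fun Omega f ->
  (forall x, Omega x -> `|f x| <= M) -> integrableO g ->
  integrableO (fun x => f x * g x).
Proof.
move=> mf fM gi; apply: (@integrableMr _ _ R mu Omega measurable_Omega _ _ mf _ gi).
by exists M; split => [|m /= Mm x Ox]; [exact: num_real|exact: le_trans (fM _ Ox) (ltW Mm)].
Qed.

Lemma continuous01_integrableM f g : continuous01 f -> integrableO g ->
  integrableO (fun x => f x * g x).
Proof.
move=> cf gi; have [M fM] := continuous01_bounded cf.
apply: (@bounded_integrableM _ _ M) => //; first exact: continuous01_measurable.
by move=> x /Omega_sub01; rewrite /= in_itv => /fM.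
Qed.

Lemma continuous01_integrableO f : continuous01 f -> integrableO f.
Proof.
move=> cf; have := continuous01_integrableM cf (integrableO_cst 1).
by apply: eq_integrableO => x _; rewrite mulr1.
Qed.

Lemma continuous01_Lq2 f : continuous01 f -> Lq 2 f.
Proof.
move=> cf; apply/Lq2P; split; first exact: continuous01_measurable.
by apply: continuous01_integrableM => //; exact: continuous01_integrableO.
Qed.

End Integrals.

(** * Primitives and integration by parts *)

Section Primitive.
Context {R : realType}.
Implicit Types (f g : R -> R) (a s x : R).
Local Notation mu := (@lebesgue_measure R).

(** The antiderivative vanishing at 0.  For x <= 1 the open interval stays
inside Omega, so that integrability over Omega suffices up to the endpoint. *)
Definition prim f (x : R) : R := \int[mu]_(t in `]0, x[) f t.

Lemma prim1 f : prim f 1 = intO f. Proof. by []. Qed.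

Lemma prim0 f : prim f 0 = 0.
Proof. by rewrite /prim set_itv_ge ?Rintegral_set0// bnd_simp ltxx. Qed.

Lemma sub_prim (x : R) : x <= 1 -> (`]0, x[%classic : set R) `<=` Omega.
Proof. by move=> x1; apply: subset_itvl; rewrite bnd_simp. Qed.

Lemma integrable_prim f x : integrableO f -> x <= 1 ->
  mu.-integrable `]0, x[ (EFin \o f).
Proof.
move=> fi x1.
by apply: (@integrableS _ _ R mu _ _ _ measurable_Omega _ (sub_prim x1)).
Qed.

Lemma primB f g x : integrableO f -> integrableO g -> x <= 1 ->
  prim (fun t => f t - g t) x = prim f x - prim g x.
Proof. by move=> *; apply: RintegralB => //; exact: integrable_prim. Qed.

Lemma prim_cst (a : R) x : 0 <= x -> prim (fun=> a) x = a * x.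
Proof.
rewrite le_eqVlt => /predU1P[<-|x0]; first by rewrite prim0 mulr0.
by rewrite /prim Rintegral_cst//= lebesgue_measure_itv/= lte_fin x0 -EFinD subr0.
Qed.

Lemma le_prim_norm f x : integrableO f -> x <= 1 ->
  `|prim f x| <= intO (fun t => `|f t|).
Proof.
move=> fi x1; apply: (le_trans (le_normr_Rintegral _ (integrable_prim fi x1))) => //.
have ni : integrableO (fun t => `|f t|) by exact: (integrable_norm fi).
apply: fine_le.
- exact: (integrable_fin_num _ (integrable_prim ni x1)).
- exact: (@integrable_fin_num _ _ R mu _ measurable_Omega _ ni).
- apply: ge0_subset_integral => //.
  + exact: measurable_Omega.
  + exact: (measurable_int _ ni).
  + exact: sub_prim.
Qed.

Lemma prim_continuous f : integrableO f -> continuous01 (prim f).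
Proof.
move=> fi.
have f0i : mu.-integrable `[0, 1] (EFin \o (f \_ Omega)).
  by apply: (integrableS measurableT _ _ (integrableO_restrict fi)).
have E x : 0 <= x -> x <= 1 ->
    parameterized_integral mu 0 x (f \_ Omega) = prim f x.
  move=> x0 x1; rewrite /parameterized_integral /prim.
  rewrite -Rintegral_itv_bndo_bndc; last first.
    apply: (integrableS _ _ _ f0i) => //; apply: subset_itvl.
    by rewrite bnd_simp.
  rewrite -Rintegral_itv_obnd_cbnd; last first.
    apply: (integrableS _ _ _ f0i) => //.
    by apply: (subset_trans (sub_prim x1)); exact: Omega_sub01.
  apply: eq_Rintegral => t; rewrite inE => /(sub_prim x1) Ot.
  by rewrite patchE mem_set.
have := parameterized_integral_continuous ler01 f0i.
apply: subspace_eq_continuous => x; rewrite inE/= in_itv/= => /andP[x0 x1].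
exact: E.
Qed.

Lemma intO_split f x : integrableO f -> 0 < x < 1 ->
  intO f = prim f x + \int[mu]_(t in `]x, 1[) f t.
Proof.
move=> fi /andP[x0 x1]; rewrite /intO /Omega.
have E : [set` `]0, 1[] = [set` `]0, x]] `|` [set` `]x, 1[] :> set R.
  by apply: itv_bndbnd_setU; rewrite bnd_simp// ltW.
have si : (`]0, x]%classic : set R) `<=` Omega by apply: subset_itvl; rewrite bnd_simp.
rewrite E Rintegral_setU//.
- by rewrite /prim (@Rintegral_itv_bndo_bndc _ (BRight 0) x)//;
    exact: (integrable_prim fi (ltW x1)).
- by rewrite -E.
- apply/disj_set2P; rewrite -subset0 => z/=; rewrite !in_itv/= => -[/andP[_ zx]].
  by rewrite ltNge zx.
Qed.

(** By Tonelli, the integral of |f(x) g(y)| is the product of the two L^1 norms. *)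
Lemma integrable_tensor f g : mu.-integrable setT (EFin \o f) ->
  mu.-integrable setT (EFin \o g) ->
  (mu \x mu)%E.-integrable setT (fun z : R * R => (f z.1 * g z.2)%:E).
Proof.
move=> fi gi.
have mf : measurable_fun setT f by case/integrableP: fi => /measurable_EFinP.
have mg : measurable_fun setT g by case/integrableP: gi => /measurable_EFinP.
apply/integrable12ltyP.
  by apply/measurable_EFinP; apply: measurable_funM; apply: measurableT_comp.
have nfi := integrable_norm fi; have ngi := integrable_norm gi.
rewrite [ltLHS](_ : _ = (\int[mu]_x (`|f x|%:E * (\int[mu]_y `|g y|)%:E))%E).
  rewrite integralZr//; apply: lte_mul_pinfty.
  - exact: integral_ge0.
  - exact: (integrable_fin_num _ nfi).
  - exact: ltry.
apply: eq_integral => x _.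
rewrite /Rintegral fineK; last exact: (integrable_fin_num _ ngi).
rewrite -integralZl//.
by apply: eq_integral => y _; rewrite /= normrM EFinM.
Qed.

(** Integrate f(x) g(y) over the triangle x < y in the two possible orders.  Fixing y
gives prim f y * g y; fixing x gives f x times the integral of g over ]x, 1[, which
is intO g - prim g x. *)
Lemma prim_by_parts f g : integrableO f -> integrableO g ->
  intO (fun x => prim f x * g x) + intO (fun x => f x * prim g x) =
  intO f * intO g.
Proof.
move=> fi gi.
pose f0 := f \_ Omega; pose g0 := g \_ Omega.
pose K (z : R * R) : R := if z.1 < z.2 then f0 z.1 * g0 z.2 else 0.
have f0i := integrableO_restrict fi; have g0i := integrableO_restrict gi.
have mf0 : measurable_fun setT f0 by case/integrableP: f0i => /measurable_EFinP.
have mg0 : measurable_fun setT g0 by case/integrableP: g0i => /measurable_EFinP.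
have mK : measurable_fun setT K.
  apply: measurable_fun_ifT => //; first exact: measurable_fun_ltr.
  by apply: measurable_funM; apply: measurableT_comp.
have Ki : (mu \x mu)%E.-integrable setT (EFin \o K).
  apply: le_integrable (integrable_tensor f0i g0i) => //.
    exact/measurable_EFinP.
  move=> z _; rewrite /= lee_fin /K; case: ifP => // _.
  by rewrite normr0.
have Ex x : (\int[mu]_y (K (x, y))%:E =
    ((fun x => f x * (intO g - prim g x)) \_ Omega x)%:E)%E.
  rewrite patchE; case: ifPn => [|xO]; last first.
    apply: integral0_eq => y _; rewrite /K/= /f0 patchE (negbTE xO).
    by rewrite mul0r if_same.
  rewrite inE => xO; have : 0 < x < 1 by move: xO; rewrite /Omega/= in_itv.
  move=> /[dup] x01 /andP[x0 x1].
  have gx : mu.-integrable `]x, 1[ (EFin \o g).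
    apply: (@integrableS _ _ R mu _ _ _ measurable_Omega _ _ gi) => //.
    by apply: subset_itvr; rewrite bnd_simp ltW.
  rewrite (intO_split gi x01) addrC addKr EFinM /Rintegral fineK; last first.
    exact: (integrable_fin_num _ gx).
  rewrite -integralZl// [RHS]integral_mkcond; apply: eq_integral => y _.
  rewrite /K /f0 /g0 !patchE [x \in Omega]mem_set//= /Omega !mem_setE !in_itv/=.
  case: (ltP x y) => [xy|] /=; last by [].
  rewrite (lt_trans x0 xy)/=; case: ifP => // _; by rewrite mulr0.
have Ey y : (\int[mu]_x (K (x, y))%:E =
    ((fun y => prim f y * g y) \_ Omega y)%:E)%E.
  rewrite patchE; case: ifPn => [|yO]; last first.
    apply: integral0_eq => x _; rewrite /K/= /g0 [g \_ _ _]patchE (negbTE yO).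
    by rewrite mulr0 if_same.
  rewrite inE => yO; have : 0 < y < 1 by move: yO; rewrite /Omega/= in_itv.
  move=> /andP[y0 y1].
  have fy := integrable_prim fi (ltW y1).
  rewrite EFinM /prim/= fineK; last exact: (integrable_fin_num _ fy).
  rewrite -integralZr// [RHS]integral_mkcond; apply: eq_integral => x _.
  rewrite /K /f0 /g0 !patchE [y \in Omega]mem_set//= /Omega !mem_setE !in_itv/=.
  case: (ltP x y) => [xy|]; last by rewrite andbF.
  rewrite (lt_trans xy y1)/= andbT; case: ifP => // _; by rewrite mul0r.
have := Fubini Ki.
under eq_integral do rewrite /= Ex.
under [RHS]eq_integral do rewrite /= Ey.
move=> /(congr1 fine); rewrite -!/(Rintegral _ _ _) -!Rintegral_mkcond -!/(intO _).
move=> <-.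
have fGi : integrableO (fun x => f x * prim g x).
  by apply: eq_integrableO (continuous01_integrableM (prim_continuous gi) fi) => x _;
     rewrite mulrC.
rewrite (@eq_intO _ _ (fun x => intO g * f x - f x * prim g x)); last first.
  by move=> x _; rewrite mulrBr (mulrC (f x)).
by rewrite intOB ?intOZ ?subrK 1?mulrC//; exact: integrableOZ.
Qed.

Lemma prim_integrable f : integrableO f -> integrableO (prim f).
Proof. by move=> /prim_continuous/continuous01_integrableO. Qed.

(** Truncating the integrand instead of the domain lets the results on integrals over
Omega apply to primitives. *)
Lemma primE g x : x <= 1 -> prim g x = intO (fun t => (t < x)%R%:R * g t).
Proof.
move=> x1; rewrite /prim /intO Rintegral_mkcond [RHS]Rintegral_mkcond.
apply: eq_Rintegral => t _; rewrite /patch /Omega !mem_setE !in_itv/=.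
case: (ltP t x) => [tx|]; first by rewrite (lt_le_trans tx x1) mul1r.
by rewrite andbF mul0r if_same.
Qed.

Lemma integrableO_cut g x : integrableO g ->
  integrableO (fun t => (t < x)%R%:R * g t).
Proof.
apply: (@bounded_integrableM _ _ _ 1) => [|t _]; last by case: (t < x); rewrite ?normr0 ?normr1.
rewrite (_ : (fun t => _) = \1_(`]-oo, x[%classic)).
  by apply: measurable_funTS; exact: measurable_indic.
by apply/funext => t; rewrite indicE mem_setE in_itv.
Qed.

Lemma ae_eq_prim f g x : integrableO f -> measurable_fun Omega g ->
  {ae mu, forall x, Omega x -> f x = g x} -> x <= 1 -> prim f x = prim g x.
Proof.
move=> fi mg fg x1.
have [gi _] := ae_eq_intO fi mg fg.
rewrite !primE//; have m := integrableO_measurable (integrableO_cut x gi).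
have [|_ //] := @ae_eq_intO _ _ (fun t => (t < x)%R%:R * g t) (integrableO_cut x fi) m.
by apply: ae_imply fg => t /[apply] ->.
Qed.

Lemma primZ a f x : integrableO f -> x <= 1 ->
  prim (fun t => a * f t) x = a * prim f x.
Proof. by move=> *; apply: RintegralZl => //; exact: integrable_prim. Qed.

Lemma cut_integrableO s : integrableO (fun t => (t < s)%R%:R).
Proof.
by apply: eq_integrableO (integrableO_cut s (integrableO_cst 1)) => t _; rewrite mulr1.
Qed.

Lemma prim_cut s x : 0 <= s -> s <= 1 -> 0 <= x -> x <= 1 ->
  prim (fun t => (t < s)%R%:R) x = Num.min x s.
Proof.
move=> s0 s1 x0 x1.
have m1 : Num.min x s <= 1 by rewrite ge_min x1.
rewrite -[RHS]mul1r -(@prim_cst 1) ?le_min ?x0// !primE//.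
apply: eq_intO => t _; rewrite lt_min mulr1.
by case: (t < x); case: (t < s); rewrite ?mulr1 ?mulr0.
Qed.

End Primitive.

(** * Explicit smooth bumps *)

Section Bump.
Context {R : realType}.
Implicit Types f g h u v : R -> R.
Local Notation mu := (@lebesgue_measure R).

Definition smooth f := forall (n : nat) (x : R), derivable (derive1n n f) x 1.

(** The functions x^-n exp (-1/x), extended by 0 to x <= 0.  All n are needed at once:
the derivative of flat n is a combination of flat n.+1 and flat n.+2. *)
Definition flat (n : nat) (x : R) : R :=
  if 0 < x then x^-1 ^+ n * expR (- x^-1) else 0.

Lemma flat_ge0 n x : 0 <= flat n x.
Proof.
rewrite /flat; case: ifP => // x0.
by rewrite mulr_ge0 ?expR_ge0// exprn_ge0// invr_ge0 ltW.
Qed.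

(** The exponential series bounds exp (1/x) from below by (1/x)^(n+2) / (n+2)!; two
of these powers pay for the factor x^2, which makes the derivative at 0 vanish. *)
Lemma flat_le n : exists C, forall x, flat n x <= C * x ^+ 2.
Proof.
exists (n.+2`!%:R) => x; rewrite /flat; case: ifPn => [x0|_]; last first.
  by rewrite mulr_ge0// sqr_ge0.
have y0 : 0 <= x^-1 by rewrite invr_ge0 ltW.
have := @expR_ge1Dxn R (x^-1) n.+1 y0.
rewrite expRN => H.
have E : x^-1 ^+ n = x ^+ 2 * x^-1 ^+ n.+2.
  by rewrite -(addn2 n) exprD mulrC -mulrA -exprMn mulVf ?expr1n ?mulr1// gt_eqF.
rewrite E -mulrA mulrC ler_pM2r ?exprn_gt0//.
rewrite ler_pdivrMr ?expR_gt0// -ler_pdivrMl ?ltr0n ?fact_gt0//.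
by apply: le_trans H; rewrite mulrC lerDr.
Qed.

Lemma is_derive_flat n (x : R) :
  is_derive x 1 (flat n) (flat n.+2 x - n%:R * flat n.+1 x).
Proof.
have [x0|x0|x0] := ltgtP x 0.
- apply: (@near_eq_is_derive _ _ _ (cst 0)).
  + near=> y; rewrite /flat ifF//; apply/negbTE; rewrite -leNgt ltW//.
    by near: y; exact: lt_nbhsl.
  + rewrite /flat !ifF ?mulr0 ?subr0; [exact: is_derive_cst|..];
    by apply/negbTE; rewrite -leNgt ltW.
- apply: (@near_eq_is_derive _ _ _
      ((fun w => w ^+ n * expR (- w)) \o (@GRing.inv R))).
  + near=> y; rewrite /flat ifT//.
    by near: y; exact: lt_nbhsr.
  + have dV : is_derive x 1 (@GRing.inv R) (- x ^- 2 *: 1).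
      by apply: (@is_deriveV _ id); rewrite ?gt_eqF.
    have dW (w : R) : is_derive w 1 (fun w : R => w ^+ n * expR (- w))
        (w ^+ n *: - expR (- w) + expR (- w) *: (n%:R * w ^+ n.-1 *: 1)).
      apply: is_deriveM.
        have -> : (fun w : R => w ^+ n) = (@id R) ^+ n by rewrite exprfctE.
        exact: is_deriveX.
      have -> : - expR (- w) = expR (- w) * -1 by rewrite mulrN1.
      exact: (@is_derive1_comp _ expR -%R).
    apply: is_derive_eq (is_derive1_comp (dW _) dV) _.
    rewrite /flat x0 !scaler1 /GRing.scale/= -exprVn.
    by case: n {dW} => [|n] /=; rewrite ?exprS ?expr0; ring.
- rewrite x0 /flat ltxx mulr0 subr0.
  have [C fC] := flat_le n.
  have H : h^-1 *: (flat n (h *: 1 + 0) - flat n 0) @[h --> 0^'] --> 0.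
    apply/cvgr0Pnorm_lt => e e0; near=> h.
    have h0 : h != 0 by near: h; exact: nbhs_dnbhs_neq.
    rewrite addr0 [h *: 1]mulr1 {2}/flat ltxx subr0 normrM normfV.
    rewrite ltr_pdivrMl ?normr_gt0// (ger0_norm (flat_ge0 _ _)).
    apply: (le_lt_trans (fC _)).
    rewrite -[h ^+ 2]ger0_norm ?sqr_ge0// normrX expr2 mulrCA ltr_pM2l ?normr_gt0//.
    apply: (@le_lt_trans _ _ (`|C| * `|h|)); first by rewrite ler_wpM2r// ler_norm.
    apply: (@le_lt_trans _ _ ((`|C| + 1) * `|h|)); first by rewrite ler_wpM2r// lerDl.
    rewrite mulrC -ltr_pdivlMr ?ltr_wpDl//.
    near: h; apply: dnbhs0_lt; by rewrite divr_gt0// ltr_wpDl.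
  apply: DeriveDef; first by apply/cvg_ex; exists 0.
  by apply/cvg_lim => //; exact: Rhausdorff.
Unshelve. all: by end_near.
Qed.

(** Multiplying the arguments by k changes the profile but not the support; letting k
tend to infinity makes the bump tend to the indicator of ]a, b[. *)
Definition bump (a b k x : R) : R := flat 0 (k * (x - a)) * flat 0 (k * (b - x)).

(** A class of functions closed under differentiation, so that all its members are
smooth; it contains the bumps and their linear combinations. *)
Inductive flat_algebra : (R -> R) -> Prop :=
| flat_algebra_cst c : flat_algebra (fun=> c)
| flat_algebra_flat n p q : flat_algebra (fun x => flat n (p * x + q))
| flat_algebraD f g : flat_algebra f -> flat_algebra g ->
    flat_algebra (fun x => f x + g x)
| flat_algebraM f g : flat_algebra f -> flat_algebra g ->
    flat_algebra (fun x => f x * g x).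

Lemma flat_algebra_derive f : flat_algebra f ->
  exists2 g, flat_algebra g & forall x : R, is_derive x 1 f (g x).
Proof.
elim=> [c|n p q|{}f g _ [f' Af' ff'] _ [g' Ag' gg']|{}f g Af [f' Af' ff'] Ag [g' Ag' gg']].
- by exists (fun=> 0); [exact: flat_algebra_cst|move=> x; exact: is_derive_cst].
- exists (fun x => p * (flat n.+2 (p * x + q)
              + - n%:R * flat n.+1 (p * x + q))).
    apply: flat_algebraM; first exact: flat_algebra_cst.
    apply: flat_algebraD; first exact: flat_algebra_flat.
    by apply: flat_algebraM; [exact: flat_algebra_cst|exact: flat_algebra_flat].
  move=> x.
  have dA : is_derive x 1 (fun y => p * y + q) (p *: 1 + 0).
    by apply: is_deriveD; exact: is_deriveZ.
  apply: is_derive_eq (@is_derive1_comp R (flat n) (fun y => p * y + q) x _ _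
    (is_derive_flat n (p * x + q)) dA) _.
  by rewrite /GRing.scale/=; ring.
- exists (fun x => f' x + g' x); first exact: flat_algebraD.
  by move=> x; exact: is_deriveD.
- exists (fun x => f x * g' x + g x * f' x).
    by apply: flat_algebraD; exact: flat_algebraM.
  by move=> x; exact: is_deriveM.
Qed.

Lemma flat_algebra_smooth f : flat_algebra f -> smooth f.
Proof.
move=> Af n x.
suff [g Ag ->] : exists2 g, flat_algebra g & derive1n n f = g.
  by have [g' _ /(_ x) []] := flat_algebra_derive Ag.
elim: n => [|n [g Ag IH]]; first by exists f.
have [g' Ag' gg'] := flat_algebra_derive Ag.
exists g' => //; rewrite derive1nS IH; apply/funext => y.
by rewrite derive1E; have [_ ->] := gg' y.
Qed.

Lemma bump_flat_algebra a b k : flat_algebra (bump a b k).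
Proof.
have -> : bump a b k = fun x => flat 0 (k * x + - (k * a)) *
    flat 0 ((- k) * x + k * b).
  apply/funext => x; rewrite /bump; congr (flat 0 _ * flat 0 _); ring.
by apply: flat_algebraM; exact: flat_algebra_flat.
Qed.

Lemma bump_smooth a b k : smooth (bump a b k).
Proof. exact/flat_algebra_smooth/bump_flat_algebra. Qed.
End Bump.

(** * The fundamental lemma of the calculus of variations *)

Section FundamentalLemma.
Context {R : realType}.
Implicit Types (f g h u v eta : R -> R) (a b k x : R).
Local Notation mu := (@lebesgue_measure R).

Lemma flat0_le1 x : flat 0 x <= 1.
Proof.
rewrite /flat; case: ifP => // x0; rewrite mul1r expR_le1 oppr_le0.
by rewrite invr_ge0 ltW.
Qed.

Lemma bump_ge0 a b k x : 0 <= bump a b k x.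
Proof. by rewrite mulr_ge0// flat_ge0. Qed.

Lemma bump_le1 a b k x : bump a b k x <= 1.
Proof. by rewrite mulr_ile1// ?flat_ge0 ?flat0_le1. Qed.

Lemma bump_eq0 a b k x : 0 < k -> ~~ (a < x < b) -> bump a b k x = 0.
Proof.
move=> k0; rewrite negb_and -!leNgt /bump /flat => /orP[xa|bx].
  by rewrite ifF ?mul0r// pmulr_rgt0// subr_gt0 ltNge xa.
by rewrite [X in _ * X]ifF ?mulr0// pmulr_rgt0// subr_gt0 ltNge bx.
Qed.

Lemma smooth_continuous f : smooth f -> continuous f.
Proof.
by move=> sf x; apply/differentiable_continuous/derivable1_diffP; exact: (sf 0).
Qed.

Lemma smooth_derive1 f : smooth f -> smooth (derive1 f).
Proof. by move=> sf n x; have := sf n.+1 x; rewrite /derive1n iterSr. Qed.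

Lemma bump_cvg a b x : a < x < b -> bump a b n.+1%:R x @[n --> \oo] --> (1 : R).
Proof.
move=> /andP[ax xb].
have C (c : R) : 0 < c -> flat 0 (n.+1%:R * c) @[n --> \oo] --> (1 : R).
  move=> c0.
  have -> : (fun n => flat 0 (n.+1%:R * c)) = expR \o (fun n => - (c^-1 * n.+1%:R^-1)).
    apply/funext => n /=; rewrite /flat ifT ?mulr_gt0// mul1r invfM mulrC.
    by rewrite [_^-1 * _]mulrC.
  have H : - (c^-1 * n.+1%:R^-1) @[n --> \oo] --> (0 : R).
    rewrite -oppr0 -(mulr0 c^-1); apply: cvgN; apply: cvgM; first exact: cvg_cst.
    exact: (@cvg_harmonic R).
  by have := cvg_comp _ _ H (@continuous_expR R 0); rewrite expR0.
by rewrite -[X in _ --> X](mulr1 (1:R)); apply: cvgM; apply: C; rewrite subr_gt0.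
Qed.

Lemma smooth_Cc_infty eta a b : smooth eta -> 0 < a -> b < 1 ->
  (forall x, ~~ (a <= x <= b) -> eta x = 0) -> Cc_infty eta.
Proof.
move=> se a0 b1 eta0; split=> //=.
have sub : closure [set x | eta x != 0] `<=` `[a, b].
  have /closure_id -> : closed (`[a, b]%classic : set R) by exact: itv_closed.
  apply: closureS => x /=; apply: contraNT; rewrite in_itv/= => /eta0 ->.
  by [].
split.
  apply: (subclosed_compact _ (@segment_compact R a b) sub).
  exact: closed_closure.
apply: (subset_trans sub) => x /=; rewrite /Omega/= !in_itv/= => /andP[ax xb].
by rewrite (lt_le_trans a0 ax) (le_lt_trans xb b1).
Qed.

Lemma bump_Cc_infty a b k : 0 < a -> b < 1 -> 0 < k -> Cc_infty (bump a b k).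
Proof.
move=> a0 b1 k0; apply: smooth_Cc_infty a0 b1 _; first exact: bump_smooth.
move=> x xab; apply: bump_eq0 => //; apply: contra xab => /andP[/ltW-> /ltW->].
by [].
Qed.

(** Dominated convergence as k tends to infinity, with |h| as the dominating function. *)
Lemma bump_orthogonal h a b : 0 <= a -> b <= 1 ->
  mu.-integrable `]a, b[ (EFin \o h) ->
  (forall k, 0 < k -> intO (fun x => h x * bump a b k x) = 0) ->
  \int[mu]_(x in `]a, b[) h x = 0.
Proof.
move=> a0 b1 hi h0.
have mh : measurable_fun `]a, b[ h by case/integrableP: hi => /measurable_EFinP.
have E k : 0 < k -> \int[mu]_(x in `]a, b[) (h x * bump a b k x) = 0.
  move=> k0; rewrite -(h0 k k0) /intO Rintegral_mkcond [RHS]Rintegral_mkcond.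
  apply: eq_Rintegral => x _; rewrite /patch /Omega !mem_setE !in_itv/=.
  case: ifPn => [/andP[ax xb]|xab].
    by rewrite (le_lt_trans a0 ax) (lt_le_trans xb b1).
  by rewrite bump_eq0// mulr0 if_same.
have mhb n : measurable_fun `]a, b[ (fun x => h x * bump a b n.+1%:R x).
  apply: measurable_funM => //; apply: measurable_funTS.
  apply: continuous_measurable_fun.
  exact: (smooth_continuous (@bump_smooth R a b n.+1%:R)).
have hb n x : `|h x * bump a b n.+1%:R x| <= `|h x|.
  by rewrite normrM ler_piMr// ger0_norm ?bump_le1// bump_ge0.
(* k runs through n + 1, as the bumps need a positive parameter *)
have [||||||_ _] := @dominated_convergence _ _ R mu `]a, b[%classic _
   (fun n x => (h x * bump a b n.+1%:R x)%:E) (EFin \o h)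
   (fun x => `|h x|%:E).
- exact: measurable_itv.
- by move=> n; apply/measurable_EFinP; exact: mhb.
- exact/measurable_EFinP.
- apply: aeW => x; rewrite /= in_itv/= => xab.
  apply/cvg_EFin; first by near=> n.
  rewrite -[X in _ --> X]mulr1; apply: cvgM; first exact: cvg_cst.
  exact: bump_cvg.
- exact: integrable_norm.
- by apply: aeW => x n _; rewrite /= lee_fin.
rewrite (_ : [sequence _]_n = cst 0%E); last first.
  apply/funext => n /=; have := E n.+1%:R; rewrite ltr0Sn => /(_ isT) En.
  rewrite /cst -[RHS]/(0%:E) -En /Rintegral fineK//.
  apply: integrable_fin_num => //.
  apply: le_integrable hi => //; first by apply/measurable_EFinP; exact: mhb.
  by move=> x _; rewrite /= lee_fin.
move=> /cvg_lim H; rewrite /Rintegral -[RHS]/(fine 0); congr fine.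
by rewrite -[LHS]H// lim_cst.
Unshelve. all: by end_near.
Qed.

(** By Lebesgue differentiation the primitive is differentiable almost everywhere with
derivative h; a null primitive has derivative zero. *)
Lemma null_primitive_ae h a b : a < b ->
  mu.-integrable `]a, b[ (EFin \o h) ->
  (forall x, a < x <= b -> \int[mu]_(t in `]a, x[) h t = 0) ->
  {ae mu, forall x, a < x < b -> h x = 0}.
Proof.
move=> ab hi h0; pose g := h \_ `]a, b[.
have gi : mu.-integrable setT (EFin \o g).
  rewrite -restrict_EFin.
  by apply: (@integrable_mkcond _ _ R mu `]a, b[ (EFin \o h) _).1.
have gl : locally_integrable setT g by apply: open_integrable_locally => //; exact: openT.
have giy y : mu.-integrable [set` Interval (BRight a) (BRight y)] (EFin \o g).
  by apply: integrableS gi.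
(* outside ]a, b[ the extension g is zero, so the primitive vanishes on the whole line *)
have F0 : (fun y => \int[mu]_(t in [set` Interval (BRight a) (BRight y)]) g t) = cst 0.
  apply/funext => y /=.
  have [ay|ya] := ltP a y; last by rewrite set_itv_ge ?Rintegral_set0// bnd_simp -leNgt.
  rewrite -Rintegral_itv_bndo_bndc; last first.
    by apply: integrableS gi.
  rewrite -(h0 (Num.min y b)); last by rewrite lt_min ay ab ge_min lexx orbT.
  rewrite Rintegral_mkcond [RHS]Rintegral_mkcond.
  apply: eq_Rintegral => x _; rewrite /g /patch !mem_setE !in_itv/= lt_min.
  by case: (a < x); case: (x < y); case: (x < b).
have := FTC1 giy gl; rewrite F0; apply: ae_imply => x + /andP[ax xb].
have ax' : (BRight a < BRight x)%O by rewrite bnd_simp.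
move=> /(_ ax')[_]; rewrite derive1_cst /g patchE mem_set//= in_itv/= ax xb.
by [].
Qed.
(** A locally integrable h may fail to be integrable near 0 and 1, so the argument runs
on [1/(n+3), 1 - 1/(n+3)] for each n, and a countable union of null sets is null. *)
Lemma fundamental_lemma h :
  (forall a b, 0 < a -> b < 1 -> mu.-integrable `]a, b[ (EFin \o h)) ->
  (forall a b k, 0 < a -> a < b -> b < 1 -> 0 < k ->
     intO (fun x => h x * bump a b k x) = 0) ->
  {ae mu, forall x, Omega x -> h x = 0}.
Proof.
move=> hi h0.
have H (n : nat) : {ae mu, forall x, n.+3%:R^-1 < x < 1 - n.+3%:R^-1 -> h x = 0}.
  have n0 : 0 < n.+3%:R^-1 :> R by rewrite invr_gt0.
  have n1 : n.+3%:R^-1 < 1 - n.+3%:R^-1 :> R.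
    rewrite ltrBrDr -mulr2n -[X in X < _]mulr_natl ltr_pdivrMr// mul1r ltr_nat.
    by [].
  apply: null_primitive_ae => //.
    by apply: hi => //; rewrite gtrBl.
  move=> x /andP[nx xn].
  have x1 : x < 1 by rewrite (le_lt_trans xn)// gtrBl.
  apply: bump_orthogonal; [exact: ltW|exact: ltW|exact: hi|].
 
  - by move=> k k0; apply: h0.
have := @ae_foralln _ _ R mu _ H; apply: ae_imply => x Hx.
rewrite /Omega/= in_itv/= => /andP[x0 x1].
pose e := Num.min x (1 - x).
have e0 : 0 < e by rewrite /e lt_min x0 subr_gt0.
have [n ne] : exists n : nat, n.+3%:R^-1 < e.
  exists (Num.Def.truncn e^-1).
  rewrite invf_plt ?posrE//.
  apply: (lt_le_trans (truncnS_gt _)); rewrite ler_nat.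
  by apply: leqW; apply: leqW.
apply: (Hx n); move: ne; rewrite lt_min => /andP[-> ?] /=.
by rewrite ltrBrDr -ltrBrDl.
Qed.

(** The zero integral is what makes the antiderivative vanish to the right of the
support as well. *)
Lemma prim_test_function chi a b : smooth chi -> 0 < a -> b < 1 ->
  (forall x, ~~ (a <= x <= b) -> chi x = 0) -> intO chi = 0 ->
  exists2 eta, Cc_infty eta & derive1 eta = chi.
Proof.
move=> schi a0 b1 chi0 Ichi.
have cchi := smooth_continuous schi.
have chiE (D : set R) : `[a, b] `<=` D -> chi \_ D = chi.
  move=> abD; apply/funext => x; rewrite patchE; case: ifPn => // /negP xD.
  rewrite chi0//; apply/negP => xab; apply: xD; rewrite inE; apply: abD.
  by rewrite /= in_itv.
have ichi : mu.-integrable setT (EFin \o chi).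
  have : mu.-integrable `[a, b] (EFin \o chi).
    apply: continuous_compact_integrable; first exact: segment_compact.
    exact: continuous_subspaceT.
  move=> /(@integrable_mkcond _ _ R mu `[a, b]%classic (EFin \o chi) _).1.
  by rewrite restrict_EFin chiE//; apply.
have iS (D : set R) : measurable D -> mu.-integrable D (EFin \o chi).
  by move=> mD; apply: integrableS ichi.
pose eta x := \int[mu]_(t in [set` `]-oo, x]]) chi t.
have D x : derivable eta x 1 /\ derive1 eta x = chi x.
  apply: (@continuous_FTC1 R chi (BInfty _ true) x (x + 1)); first by rewrite ltrDl.
  - exact: iS.
  - by rewrite ltNyr.
  - exact: cchi.
have De : derive1 eta = chi by apply/funext => x; case: (D x).
exists eta; last exact: De.
apply: (@smooth_Cc_infty _ a b) => //.
  case=> [|n] x; first by case: (D x).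
  by rewrite /derive1n iterSr De; exact: schi.
move=> x; rewrite negb_and -!ltNge => /orP[xa|bx]; rewrite /eta Rintegral_mkcond.
  rewrite (_ : _ \_ _ = cst 0) ?Rintegral_cst ?mul0r//.
  apply/funext => t; rewrite patchE; case: ifPn => //; rewrite inE/= in_itv/= => tx.
  by rewrite chi0// negb_and -!ltNge (le_lt_trans tx xa).
rewrite -[RHS]Ichi [RHS]/intO [RHS]Rintegral_mkcond !chiE//.
  by move=> t /=; rewrite /Omega/= !in_itv/= => /andP[/(lt_le_trans a0)->/le_lt_trans->].
by move=> t /=; rewrite !in_itv/= => /andP[_ /le_lt_trans tb]; apply/ltW/tb.
Qed.

End FundamentalLemma.

(** * The lemma of du Bois-Reymond *)

Section DuBoisReymond.
Context {R : realType}.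
Implicit Types (f g h u v eta : R -> R) (a b k x : R).
Local Notation mu := (@lebesgue_measure R).

Lemma bump_integrableO a b k : integrableO (bump a b k).
Proof.
apply: continuous01_integrableO; apply: continuous_subspaceT.
exact: (smooth_continuous (@bump_smooth R a b k)).
Qed.

Lemma bump_integrableM h a b k : integrableO h ->
  integrableO (fun x => h x * bump a b k x).
Proof.
move=> hi; have cb : continuous01 (bump a b k).
  by apply: continuous_subspaceT; exact: (smooth_continuous (@bump_smooth R a b k)).
by apply: eq_integrableO (continuous01_integrableM cb hi) => x _; rewrite mulrC.
Qed.

(** If all these bumps had zero integral, the constant 1 would be orthogonal to them and
its integral over the interval would vanish. *)
Lemma bump_intO_neq0 : exists2 k, 0 < k & intO (bump (4^-1 : R) (3 / 4) k) != 0.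
Proof.
apply: contrapT => H.
have : \int[mu]_(x in `]4^-1, (3 / 4)[) cst (1 : R) x = 0.
  apply: bump_orthogonal; [by []|by lra| |].
    apply: (@integrableS _ _ R mu _ _ _ measurable_Omega _ _ (integrableO_cst 1)) => //.
    by move=> x; rewrite /Omega/= !in_itv/=; lra.
  move=> k k0; apply/eqP; apply: contrapT => Hk; apply: H; exists k => //.
  apply: contra_notN Hk => /eqP <-; apply/eqP; apply: eq_intO => x _.
  by rewrite mul1r.
rewrite Rintegral_cst//= lebesgue_measure_itv/= lte_fin ifT -?EFinD/=; lra.
Qed.

(** For a bump psi and a fixed bump psi0 of integral m, the function
m psi - (int psi) psi0 has zero integral, so it is the derivative of a test function.
Orthogonality of h to it says that h - c is orthogonal to psi, where
c = (int h psi0) / m. *)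
Lemma du_bois_reymond h : integrableO h ->
  (forall eta, Cc_infty eta -> intO (fun x => h x * derive1 eta x) = 0) ->
  exists c, {ae mu, forall x, Omega x -> h x = c}.
Proof.
move=> hi H; have [k0 k00] := bump_intO_neq0.
set psi0 := bump _ _ k0; set m := intO psi0 => m0.
pose c := intO (fun x => h x * psi0 x) / m; exists c.
suff : {ae mu, forall x, Omega x -> h x - c = 0}.
  by apply: ae_imply => x /[apply] /eqP; rewrite subr_eq0 => /eqP.
apply: fundamental_lemma.
  move=> a b a0 b1.
  have hc := integrableOB hi (integrableO_cst c).
  apply: (@integrableS _ _ R mu _ _ _ measurable_Omega _ _ hc) => //.
  by apply: subset_itv; rewrite bnd_simp ltW.
move=> a b k a0 ab b1 k_gt0; set psi := bump a b k.
pose chi x := m * psi x + - intO psi * psi0 x.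
have psii : integrableO psi := bump_integrableO _ _ _.
have psi0i : integrableO psi0 := bump_integrableO _ _ _.
have schi : smooth chi.
  apply: flat_algebra_smooth.
  by apply: flat_algebraD; apply: flat_algebraM;
    [exact: flat_algebra_cst|exact: bump_flat_algebra|
     exact: flat_algebra_cst|exact: bump_flat_algebra].
(* the support of chi lies in the hull of the two supports *)
have [|||||eta Ceta etaE] := @prim_test_function R chi (Num.min a 4^-1) (Num.max b (3/4)).
- exact: schi.
- by rewrite lt_min a0/= invr_gt0 ltr0n.
- by rewrite gt_max b1/=; lra.
- move=> x xab; rewrite /chi /psi /psi0 !bump_eq0 ?mulr0 ?addr0//.
    by apply: contra xab => /andP[/ltW ax /ltW xb]; rewrite ge_min le_max ax xb ?orbT.
  by apply: contra xab => /andP[/ltW ax /ltW xb]; rewrite ge_min le_max ax xb ?orbT.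
- rewrite intOD ?intOZ//; try exact: integrableOZ.
  by rewrite mulNr [X in X - _]mulrC subrr.
have := H _ Ceta; rewrite etaE.
have hpi := bump_integrableM a b k hi.
have hp0i := bump_integrableM 4^-1 (3/4) k0 hi.
rewrite (@eq_intO _ _
  (fun x => m * (h x * psi x) + - intO psi * (h x * psi0 x))); last first.
  by move=> x _; rewrite /chi; ring.
rewrite intOD ?intOZ//; try exact: integrableOZ.
move=> Hm; rewrite (@eq_intO _ _ (fun x => h x * psi x - c * psi x)); last first.
  by move=> x _; ring.
rewrite intOB ?intOZ//; last exact: integrableOZ.
apply: (mulfI m0); rewrite mulr0 -Hm /c mulrBr mulrA.
by rewrite (mulrC m (_ / m)) divfK// (mulrC _ (intO psi)) mulNr.
Qed.
End DuBoisReymond.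

(** * Weak derivatives on the interval *)

Section Sobolev.
Context {R : realType}.
Implicit Types (f g h u v eta : R -> R) (a b k x : R).
Local Notation mu := (@lebesgue_measure R).

Lemma locally_integrable_itv g a b : locally_integrable Omega g ->
  0 < a -> b < 1 -> mu.-integrable `]a, b[ (EFin \o g).
Proof.
move=> [mg _ gi] a0 b1.
have ab01 : (`[a, b]%classic : set R) `<=` Omega.
  by move=> x; rewrite /Omega/= !in_itv/= => /andP[/(lt_le_trans a0)-> /le_lt_trans->].
apply: (@integrableS _ _ R mu `[a, b]%classic) => //.
  exact: subset_itv_oo_cc.
apply/integrableP; split.
  apply/measurable_EFinP.
  exact: (measurable_funS measurable_Omega ab01).
by apply: gi => //; exact: segment_compact.
Qed.

Lemma locally_integrable_bump g a b k : locally_integrable Omega g ->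
  0 < a -> b < 1 -> 0 < k -> integrableO (fun x => g x * bump a b k x).
Proof.
move=> gl a0 b1 k0.
have gi := locally_integrable_itv gl a0 b1.
have gi0 : mu.-integrable setT (EFin \o (g \_ `]a, b[)).
  rewrite -restrict_EFin.
  by apply: (@integrable_mkcond _ _ R mu `]a, b[ (EFin \o g) _).1.
have gO : integrableO (g \_ `]a, b[).
  by apply: (@integrableS _ _ R mu _ _ _ measurableT _ _ gi0) => //; exact: measurable_Omega.
have := bump_integrableM a b k gO; apply: eq_integrableO => x _.
rewrite patchE; case: ifPn => //; rewrite mem_setE in_itv/= => xab.
by rewrite bump_eq0// !mulr0.
Qed.

(** Both derivatives have the same integral against every test function, so the
fundamental lemma applies to their difference. *)
Lemma weak_derivative_unique u g h : weak_derivative u g -> weak_derivative u h ->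
  {ae mu, forall x, Omega x -> g x = h x}.
Proof.
move=> [_ gl gu] [_ hl hu].
suff : {ae mu, forall x, Omega x -> g x - h x = 0}.
  by apply: ae_imply => x /[apply] /eqP; rewrite subr_eq0 => /eqP.
apply: fundamental_lemma.
  move=> a b a0 b1; apply: (@integrableB _ _ R mu _ _ (EFin \o g) (EFin \o h)) => //;
  exact: locally_integrable_itv.
move=> a b k a0 ab b1 k0.
rewrite (@eq_intO _ _ (fun x => g x * bump a b k x - h x * bump a b k x)); last first.
  by move=> x _; rewrite mulrBl.
rewrite intOB; [|exact: locally_integrable_bump..].
have Cb := bump_Cc_infty a0 b1 k0.
by have := gu _ Cb; rewrite hu// => /oppr_inj ->; rewrite subrr.
Qed.

Lemma wderivP u g : weak_derivative u g -> weak_derivative u (wderiv u).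
Proof. by move=> ug; apply: (@xgetPex _ _ [set g | weak_derivative u g]); exists g. Qed.

(** The chosen representative agrees almost everywhere with the square integrable one. *)
Lemma H1_wderiv u : H1 u -> weak_derivative u (wderiv u) /\ Lq 2 (wderiv u).
Proof.
move=> [_ _ [g ug g2]]; have wu := wderivP ug; split=> //.
by apply: ae_eq_Lq2 g2 _ (weak_derivative_unique ug wu); case: wu => _ [].
Qed.

Lemma H1_continuous01 u : H1 u -> continuous01 u. Proof. by case. Qed.

Lemma H1_wderiv_integrableO u : H1 u -> integrableO (wderiv u).
Proof. by move=> /H1_wderiv[_] /Lq2_integrableO. Qed.

Lemma Cc_infty_smooth eta : Cc_infty eta -> smooth eta. Proof. by case. Qed.

Lemma smooth_continuous01 f : smooth f -> continuous01 f.
Proof. by move=> /smooth_continuous; exact: continuous_subspaceT. Qed.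

Lemma Cc_infty_continuous01 eta : Cc_infty eta -> continuous01 eta.
Proof. by move=> /Cc_infty_smooth/smooth_continuous01. Qed.

Lemma Cc_infty_derive_continuous01 eta : Cc_infty eta -> continuous01 (derive1 eta).
Proof. by move=> /Cc_infty_smooth/smooth_derive1/smooth_continuous01. Qed.

Lemma Cc_infty_out eta x : Cc_infty eta -> ~ Omega x -> eta x = 0.
Proof.
move=> [_ [_ sub]] xO; apply/eqP; apply: contrapT => /negP ex.
by apply: xO; apply: sub; exact: subset_closure.
Qed.

Lemma Cc_infty0 eta : Cc_infty eta -> eta 0 = 0.
Proof. by move=> /Cc_infty_out; apply; rewrite /Omega/= in_itv/= ltxx. Qed.

Lemma Cc_infty1 eta : Cc_infty eta -> eta 1 = 0.
Proof. by move=> /Cc_infty_out; apply; rewrite /Omega/= in_itv/= ltxx andbF. Qed.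

Lemma prim_derive1 f x : smooth f -> 0 <= x -> x <= 1 ->
  prim (derive1 f) x = f x - f 0.
Proof.
move=> sf; rewrite le_eqVlt => /predU1P[<- _|x0 x1]; first by rewrite prim0 subrr.
have cf := smooth_continuous sf; have cf' := smooth_continuous (smooth_derive1 sf).
have fi : mu.-integrable `[0, x] (EFin \o derive1 f).
  apply: continuous_compact_integrable; first exact: segment_compact.
  exact: continuous_subspaceT.
have E : \int[mu]_(t in `[0, x]) (derive1 f t) = f x - f 0.
  rewrite /Rintegral (@continuous_FTC2 _ _ f)//.
    exact: continuous_subspaceT.
  split.
  - by move=> y _; exact: (sf 0).
  - exact/cvg_at_right_filter/cf.
  - exact/cvg_at_left_filter/cf.
rewrite -E /prim.
rewrite -[RHS]Rintegral_itv_obnd_cbnd; last first.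
  apply: integrableS fi => //; apply: subset_itvr.
  by rewrite bnd_simp.
rewrite -[RHS]Rintegral_itv_bndo_bndc//.
by apply: integrableS fi => //; exact: subset_itv_oo_cc.
Qed.

(** The weak derivative of a primitive is the integrand: a test function is the primitive
of its derivative and vanishes at 1. *)
Lemma prim_test_by_parts g eta : integrableO g -> Cc_infty eta ->
  intO (fun x => prim g x * derive1 eta x) = - intO (fun x => g x * eta x).
Proof.
move=> gi Ce.
have ei := continuous01_integrableO (Cc_infty_derive_continuous01 Ce).
have P x : 0 <= x -> x <= 1 -> prim (derive1 eta) x = eta x.
  by move=> *; rewrite prim_derive1 ?(Cc_infty0 Ce) ?subr0//; exact: Cc_infty_smooth.
have := prim_by_parts gi ei.
rewrite -[intO (derive1 eta)]prim1 P// (Cc_infty1 Ce) mulr0 => /eqP.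
rewrite addr_eq0 => /eqP ->; congr (- _); apply: eq_intO => x.
by rewrite /Omega/= in_itv/= => /andP[/ltW ? /ltW ?]; rewrite P.
Qed.

(** If h x differs from c, then so does h near x; the points of Omega near x contain an
open interval, even when x is an endpoint, and this is not a null set. *)
Lemma ae_eq_continuous01 h c : continuous01 h ->
  {ae mu, forall x, Omega x -> h x = c} -> forall x, 0 <= x <= 1 -> h x = c.
Proof.
move=> ch [N [mN N0 hN]] x x01; apply/eqP; apply: contrapT => /negP hxc.
have x01' : `[0, 1]%classic x by rewrite /= in_itv.
have := (subspace_continuousP _ _).1 ch x x01'.
have hc0 : 0 < `|h x - c| by rewrite normr_gt0 subr_eq0.
move=> /cvgr_dist_lt/(_ _ hc0); rewrite /within/= => -[e /= e0 He].
(* ]l, r[ is the trace on Omega of the neighbourhood of x on which h differs from c *)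
pose l := Num.max 0 (x - e); pose r := Num.min 1 (x + e).
have lr : l < r.
  by rewrite /l /r lt_min !gt_max; move/andP: x01 => [? ?]; lra.
have sub : `]l, r[ `<=` N.
  move=> y; rewrite /= in_itv/= gt_max lt_min => /andP[/andP[y0 ye] /andP[y1 ye']].
  apply: hN => /= H.
  have y01 : `[0, 1]%classic y by rewrite /= in_itv/= !ltW.
  have hy : h y = c by apply: H; rewrite /Omega/= in_itv/= y0.
  have yx : `|x - y| < e by rewrite ltr_distlC ye' andbT; move: ye; lra.
  by have := He y yx y01; rewrite /from_subspace /= hy ltxx.
have : (mu `]l, r[ <= mu N)%E by apply: le_measure; rewrite ?inE//=.
by rewrite N0 /= lebesgue_measure_itv/= lte_fin lr -EFinB lee_fin subr_le0 leNgt lr.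
Qed.

(** The difference u - prim (wderiv u) has zero weak derivative, so it is constant almost
everywhere by du Bois-Reymond, and everywhere on [0, 1] by continuity. *)
Lemma H1_prim u x : H1 u -> 0 <= x <= 1 -> u x = u 0 + prim (wderiv u) x.
Proof.
move=> Hu; have [wu _] := H1_wderiv Hu; have gi := H1_wderiv_integrableO Hu.
have cu := H1_continuous01 Hu.
pose h x := u x - prim (wderiv u) x.
have ch : continuous01 h.
  by move=> y; apply: continuousB; [exact: cu|exact: (prim_continuous gi)].
have [eta Ceta|c hc] := du_bois_reymond (continuous01_integrableO ch).
  have ce' := Cc_infty_derive_continuous01 Ceta.
  have ei := continuous01_integrableO ce'.
  rewrite (@eq_intO _ _
    (fun x => u x * derive1 eta x - prim (wderiv u) x * derive1 eta x)); last first.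
    by move=> y _; rewrite mulrBl.
  rewrite intOB; [|exact: continuous01_integrableM|].
  - by case: wu => _ _ ->//; rewrite prim_test_by_parts// subrr.
  - by apply: continuous01_integrableM ei; exact: prim_continuous.
have H := ae_eq_continuous01 ch hc.
move=> /H; rewrite /h => hx; have := H 0; rewrite lexx ler01 => /(_ isT).
rewrite /h prim0 subr0 => ->; rewrite -hx subrK.
by [].
Qed.

Lemma H1B u v : H1 u -> H1 v -> H1 (u \- v).
Proof.
move=> Hu Hv; have [[ul gl wu] g2] := H1_wderiv Hu; have [[vl kl wv] k2] := H1_wderiv Hv.
have gi := Lq2_integrableO g2; have ki := Lq2_integrableO k2.
have cu := H1_continuous01 Hu; have cv := H1_continuous01 Hv.
split.
- by move=> y; apply: continuousB; [exact: cu|exact: cv].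
- by apply: Lq2B; [case: Hu|case: Hv].
- exists (fun x => wderiv u x - wderiv v x); last exact: Lq2B.
  split; [exact: locally_integrableB|exact: locally_integrableB|].
  move=> eta Ceta.
  have ce := Cc_infty_continuous01 Ceta.
  have ei := continuous01_integrableO (Cc_infty_derive_continuous01 Ceta).
  have M g : integrableO g -> integrableO (fun x => g x * eta x).
    by move=> ig; apply: eq_integrableO (continuous01_integrableM ce ig) => x _; rewrite mulrC.
  rewrite (@eq_intO _ _ (fun x => u x * derive1 eta x - v x * derive1 eta x)); last first.
    by move=> y _; rewrite /= mulrBl.
  rewrite intOB; [|exact: continuous01_integrableM..].
  rewrite wu// wv//.
  rewrite [in RHS](@eq_intO _ _
    (fun x => wderiv u x * eta x - wderiv v x * eta x)); last first.
    by move=> y _; rewrite mulrBl.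
  rewrite intOB; [|exact: M..].
  by rewrite opprB opprK addrC.
Qed.

Lemma Cc_infty_weak_derivative eta : Cc_infty eta -> weak_derivative eta (derive1 eta).
Proof.
move=> Ce.
have ei := continuous01_integrableO (Cc_infty_continuous01 Ce).
have ei' := continuous01_integrableO (Cc_infty_derive_continuous01 Ce).
split; try by apply: open_integrable_locally => //; exact: open_Omega.
move=> zeta Cz; rewrite -prim_test_by_parts//; apply: eq_intO => x.
rewrite /Omega/= in_itv/= => /andP[/ltW ? /ltW ?].
by rewrite prim_derive1 ?(Cc_infty0 Ce) ?subr0//; exact: Cc_infty_smooth.
Qed.

Lemma Cc_infty_H1 eta : Cc_infty eta -> H1 eta.
Proof.
move=> Ce; split; first exact: Cc_infty_continuous01.
  exact: continuous01_Lq2 (Cc_infty_continuous01 Ce).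
exists (derive1 eta); first exact: Cc_infty_weak_derivative.
exact: continuous01_Lq2 (Cc_infty_derive_continuous01 Ce).
Qed.

End Sobolev.

(** * The Dirichlet problem *)

Section Dirichlet.
Context {R : realType}.
Implicit Types (f g h u v eta : R -> R) (a b e k s x : R).
Local Notation mu := (@lebesgue_measure R).

Lemma integrableO_norm f : integrableO f -> integrableO (fun x => `|f x|).
Proof. by move=> fi; exact: (integrable_norm fi). Qed.

(** Young's inequality |t| <= (e + t^2 / e) / 2 replaces Cauchy-Schwarz: with a squared
norm below e^2 the bound is at most e. *)
Lemma Lq2_intO_norm g e : Lq 2 g -> 0 < e ->
  intO (fun x => `|g x|) <= (e + intO (fun x => g x ^+ 2) / e) / 2.
Proof.
move=> g2 e0; have gi := Lq2_integrableO g2; have ggi := ((Lq2P _).1 g2).2.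
rewrite (_ : (_ + _) / 2 = intO (fun x => e / 2 + (e^-1 / 2) * g x ^+ 2)).
  apply: le_intO; first exact: integrableO_norm.
    by apply: integrableOD; [exact: integrableO_cst|exact: integrableOZ].
  move=> x _; rewrite -(ler_pM2l e0).
  have -> : e * (e / 2 + e^-1 / 2 * g x ^+ 2) = (e ^+ 2 + `|g x| ^+ 2) / 2.
    by rewrite real_normK ?num_real//; field; rewrite gt_eqF.
  have := sqr_ge0 (e - `|g x|); rewrite sqrrB; lra.
rewrite intOD ?intO_cst ?intOZ//; [by field; rewrite gt_eqF|exact: integrableO_cst|].
exact: integrableOZ.
Qed.

(** Averaging |u 0| <= |u x| + int |u'| over x controls the boundary values by the L^1 norms
of u and u', each at most e. *)
Lemma H1_trace_le u e : H1 u -> 0 < e -> H1norm u < e ->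
  `|u 0| <= 4 * e /\ `|u 1| <= 4 * e.
Proof.
move=> Hu e0 ue.
have [_ w2] := H1_wderiv Hu; have [cu u2 _] := Hu.
have wi := Lq2_integrableO w2; have ui := Lq2_integrableO u2.
have Ne : intO (fun x => u x ^+ 2) + intO (fun x => wderiv u x ^+ 2) < e ^+ 2.
  rewrite ltNge; apply/negP => H; move: ue; rewrite ltNge => /negP; apply.
  by rewrite -[leLHS]ger0_norm ?(ltW e0)// -sqrtr_sqr ler_wsqrtr.
set A := intO _ in Ne; set B := intO _ in Ne.
have A0 : 0 <= A by apply: Rintegral_ge0 => x _; exact: sqr_ge0.
have B0 : 0 <= B by apply: Rintegral_ge0 => x _; exact: sqr_ge0.
have UA := Lq2_intO_norm u2 e0; have WB := Lq2_intO_norm w2 e0.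
rewrite -/A -/B in UA WB.
have eA : A / e <= e by rewrite ler_pdivrMr// -expr2; lra.
have eB : B / e <= e by rewrite ler_pdivrMr// -expr2; lra.
have u0 : `|u 0| <= intO (fun x => `|u x|) + intO (fun x => `|wderiv u x|).
  rewrite -[leLHS]intO_cst -lerBlDr -[X in _ - X]intO_cst.
  rewrite -intOB; [|exact: integrableO_cst..].
  apply: le_intO; [exact: integrableO_cst|exact: integrableO_norm|].
  move=> x; rewrite /Omega/= in_itv/= => /andP[/ltW x0 /ltW x1].
  rewrite (@H1_prim _ u x)// ?x0// lerBlDr.
  have := le_prim_norm wi x1; have := ler_normB (u 0 + prim (wderiv u) x) (prim (wderiv u) x).
  by rewrite addrK; lra.
have u1 : `|u 1| <= `|u 0| + intO (fun x => `|wderiv u x|).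
  rewrite (@H1_prim _ u 1) ?ler01 ?lexx//.
  by apply: (le_trans (ler_normD _ _)); rewrite lerD2l le_prim_norm.
by split; lra.
Qed.

(** The approximating test functions vanish at 0 and 1, and the trace is continuous for
the H^1 norm. *)
Lemma H10_boundary u : H10 u -> u 0 = 0 /\ u 1 = 0.
Proof.
move=> [Hu Du].
have H e : 0 < e -> `|u 0| <= e /\ `|u 1| <= e.
  move=> e0; have e4 : 0 < e / 4 by lra.
  have [eta Ce /(H1_trace_le (H1B Hu (Cc_infty_H1 Ce)) e4)] := Du _ e4.
  by rewrite /= (Cc_infty0 Ce) (Cc_infty1 Ce) !subr0 mulrCA divff ?mulr1.
by split; apply/eqP; rewrite -normr_le0; apply/ler_addgt0Pl => e /H[]; rewrite addr0.
Qed.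

(** A test function approximates itself; that the H^1 norm of the zero function is zero
still requires uniqueness of the weak derivative, as the representative is chosen. *)
Lemma Cc_infty_H10 eta : Cc_infty eta -> H10 eta.
Proof.
move=> Ce; split=> [|e e0]; first exact: Cc_infty_H1.
exists eta => //.
have -> : eta \- eta = cst 0 by apply/funext => x /=; rewrite subrr.
have C0 : Cc_infty (cst 0 : R -> R).
  apply: (@smooth_Cc_infty _ _ 4^-1 (3/4)) => //; last by lra.
  exact/flat_algebra_smooth/flat_algebra_cst.
have w0 := Cc_infty_weak_derivative C0.
have w20 : {ae mu, forall x, Omega x -> 0 = wderiv (cst 0) x ^+ 2 :> R}.
  apply: ae_imply (weak_derivative_unique w0 (wderivP w0)) => x /[apply] <-.
  by rewrite derive1_cst expr0n.
have mw := integrableO_measurable (H1_wderiv_integrableO (Cc_infty_H1 C0)).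
have [_ wd] := ae_eq_intO (integrableO_cst 0) (measurable_funX 2 mw) w20.
rewrite /H1norm -wd intO_cst.
rewrite (@eq_intO _ _ (cst 0)) ?intO_cst ?addr0 ?sqrtr0//.
by move=> x _; rewrite /= expr0n.
Qed.

(** Integrating int f eta by parts turns the weak equation into
int (u' + prim f) eta' = 0. *)
Lemma dirichlet_derivative f u : integrableO f -> weak_dirichlet_solution f u ->
  exists c, {ae mu, forall x, Omega x -> wderiv u x = c - prim f x}.
Proof.
move=> fi [Hu sol]; have [Hu1 _] := Hu.
have wi := H1_wderiv_integrableO Hu1.
have [|eta Ce|c hc] := @du_bois_reymond _ (fun x => wderiv u x + prim f x).
- by apply: integrableOD => //; exact: prim_integrable.
- have ce' := Cc_infty_derive_continuous01 Ce.
  have ei' := continuous01_integrableO ce'.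
  have wde : {ae mu, forall x, Omega x -> derive1 eta x = wderiv eta x}.
    have w := Cc_infty_weak_derivative Ce.
    exact: weak_derivative_unique w (wderivP w).
  have wei : integrableO (fun x => wderiv u x * derive1 eta x).
    by apply: eq_integrableO (continuous01_integrableM ce' wi) => x _; rewrite mulrC.
  have mw := measurable_funM (integrableO_measurable wi)
    (integrableO_measurable (H1_wderiv_integrableO (Cc_infty_H1 Ce))).
  have wwe : {ae mu, forall x, Omega x ->
      wderiv u x * derive1 eta x = wderiv u x * wderiv eta x}.
    by apply: ae_imply wde => x /[apply] ->.
  have := sol _ (Cc_infty_H10 Ce); have [_ <-] := ae_eq_intO wei mw wwe.
  move=> E.
  rewrite (@eq_intO _ _
    (fun x => wderiv u x * derive1 eta x + prim f x * derive1 eta x)); last first.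
    by move=> x _; rewrite mulrDl.
  rewrite intOD//; last exact: continuous01_integrableM (prim_continuous fi) ei'.
  by rewrite prim_test_by_parts// E subrr.
- by exists c; apply: ae_imply hc => x /[apply] <-; rewrite addrK.
Qed.

(** Replace u' by c - prim f and integrate prim f * v' by parts. *)
Lemma dirichlet_green f u v c : integrableO f -> H1 u -> H1 v ->
  {ae mu, forall x, Omega x -> wderiv u x = c - prim f x} ->
  intO (fun x => wderiv u x * wderiv v x) - intO (fun x => f x * v x) =
  (c - prim f 1) * v 1 - c * v 0.
Proof.
move=> fi Hu Hv uc.
have wui := H1_wderiv_integrableO Hu; have wvi := H1_wderiv_integrableO Hv.
have cv := H1_continuous01 Hv; have cF := prim_continuous fi.
have Fvi := continuous01_integrableM cF wvi.
have cFvi : integrableO (fun x => c * wderiv v x - prim f x * wderiv v x).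
  by apply: integrableOB => //; exact: integrableOZ.
have mwv := measurable_funM (integrableO_measurable wui) (integrableO_measurable wvi).
have uvc : {ae mu, forall x, Omega x ->
    c * wderiv v x - prim f x * wderiv v x = wderiv u x * wderiv v x}.
  by apply: ae_imply uc => x /[apply] ->; rewrite mulrBl.
have [_ <-] := ae_eq_intO cFvi mwv uvc.
rewrite intOB ?intOZ//; last exact: integrableOZ.
have fvi : integrableO (fun x => f x * prim (wderiv v) x).
  have := continuous01_integrableM (prim_continuous wvi) fi.
  by apply: eq_integrableO => x _; rewrite mulrC.
have -> : intO (fun x => f x * v x) = v 0 * intO f + intO (fun x => f x * prim (wderiv v) x).
  rewrite -intOZ// -intOD//; last exact: integrableOZ.
  apply: eq_intO => x; rewrite /Omega/= in_itv/= => /andP[/ltW x0 /ltW x1].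
  by rewrite (@H1_prim _ v x) ?x0//; ring.
have := prim_by_parts fi wvi; have := @H1_prim _ v 1 Hv; rewrite ler01 lexx => /(_ isT).
rewrite !prim1 => ->; set I1 := intO _; set I2 := intO _ => E.
have -> : I2 = intO f * intO (wderiv v) - I1 by rewrite -E; ring.
by ring.
Qed.
End Dirichlet.

(** * The hat functions *)

Section Hat.
Context {R : realType}.
Implicit Types (f g h u v : R -> R) (a b s x : R).
Local Notation mu := (@lebesgue_measure R).

(** On ]- s, 2 - s[ the two reflected kernels at - s and 2 - s are away from their kinks, hence
affine, and only the kink of Gamma s at s remains. *)
Lemma phi_affine s x : 0 < s < 1 -> - s < x < 2 - s ->
  phi s x = acoef s * Gamma s x +
    (((1 - s) / (2 * s) - s / (2 * (1 - s))) * x +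
     ((1 - s) / 2 + (2 - s) * s / (2 * (1 - s)))).
Proof.
move=> /andP[s0 s1] /andP[xs x2]; rewrite /phi /acoef /Gamma.
have -> : `|x - - s| = x + s by rewrite ger0_norm; lra.
have -> : `|x - (2 - s)| = 2 - s - x by rewrite ler0_norm; lra.
have -> : `|1 - s| = 1 - s by rewrite ger0_norm; lra.
have -> : `|1 - - s| = 1 + s by rewrite ger0_norm; lra.
have -> : `|0 - s| = s by rewrite ler0_norm; lra.
have -> : `|0 - (2 - s)| = 2 - s by rewrite ler0_norm; lra.
field; rewrite ?gt_eqF ?subr_gt0//; lra.
Qed.

Lemma phi_hat s x : 0 < s < 1 -> 0 <= x <= 1 ->
  phi s x = acoef s * Num.min x s - (1 - s)^-1 * x.
Proof.
move=> /[dup] s01 /andP[s0 s1] /andP[x0 x1].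
rewrite phi_affine//; last by lra.
rewrite /acoef /Gamma; case: (leP x s) => [xs|sx].
  rewrite ler0_norm; last by lra.
  by field; rewrite ?gt_eqF ?subr_gt0//; lra.
rewrite ger0_norm; last by lra.
by field; rewrite ?gt_eqF ?subr_gt0//; lra.
Qed.

(** The hat function has slope 1 / s = a_s - 1 / (1 - s) left of s and - 1 / (1 - s)
right of it. *)
Lemma phi_prim s x : 0 < s < 1 -> 0 <= x <= 1 ->
  phi s x = prim (fun t => acoef s * (t < s)%R%:R - (1 - s)^-1) x.
Proof.
move=> /[dup] s01 /andP[s0 s1] /[dup] x01 /andP[x0 x1].
have ki := cut_integrableO s.
rewrite phi_hat// primB ?prim_cst//; [|exact: integrableOZ|exact: integrableO_cst].
by rewrite primZ// prim_cut// ltW.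
Qed.

Lemma intO_phi f s : integrableO f -> 0 < s < 1 ->
  intO (fun x => f x * phi s x) =
  (1 - s)^-1 * prim (prim f) 1 - acoef s * prim (prim f) s.
Proof.
move=> fi /[dup] s01 /andP[s0 s1].
pose k t := acoef s * (t < s)%R%:R - (1 - s)^-1.
have ki : integrableO k.
  apply: integrableOB; last exact: integrableO_cst.
  by apply: integrableOZ; exact: cut_integrableO.
have k0 : intO k = 0.
  rewrite -prim1 -phi_prim ?lexx ?ler01// phi_hat ?lexx ?ler01// min_r ?ltW// /acoef.
  by field; rewrite ?gt_eqF ?subr_gt0//; lra.
rewrite (@eq_intO _ _ (fun x => f x * prim k x)); last first.
  by move=> x /Omega_sub01; rewrite /= in_itv/= => x01; rewrite phi_prim.
have Fi := prim_integrable fi.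
have := prim_by_parts fi ki; rewrite k0 mulr0 addrC => /eqP.
rewrite addr_eq0 => /eqP ->.
rewrite (@eq_intO _ _
  (fun x => acoef s * ((x < s)%R%:R * prim f x) - (1 - s)^-1 * prim f x)); last first.
  by move=> x _; rewrite /k; ring.
rewrite intOB ?intOZ//; try exact: integrableOZ; try exact: integrableO_cut.
  by rewrite -primE ?ltW// prim1 opprB.
by apply: integrableOZ; exact: integrableO_cut.
Qed.

(** Openness of U transports the derivatives of the affine function to H. *)
Lemma affine_regular (H : R -> R) (U : set R) (a b : R) : open U ->
  (forall x, U x -> H x = a * x + b) -> forall x, U x ->
  [/\ derivable H x 1, derivable (derive1 H) x 1,
      {for x, continuous (derive1n 2 H)} & derive1n 2 H x = 0].
Proof.
move=> oU HU.
have near (f g : R -> R) : (forall x, U x -> f x = g x) -> forall x, U x ->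
    \forall y \near x, g y = f y.
  by move=> fg x Ux; apply: filterS (open_nbhs_nbhs (conj oU Ux)) => y /fg.
have dA x : is_derive x 1 (fun y : R => a * y + b) (a *: 1 + 0).
  by apply: is_deriveD; exact: is_deriveZ.
have dH x : U x -> is_derive x 1 H a.
  move=> Ux; apply: near_eq_is_derive (near _ _ HU x Ux) _.
  by apply: is_derive_eq (dA x) _; rewrite addr0 /GRing.scale/= mulr1.
have H1 x : U x -> derive1 H x = cst a x.
  by move=> /dH[_]; rewrite derive1E.
have dH1 x : U x -> is_derive x 1 (derive1 H) 0.
  by move=> Ux; apply: near_eq_is_derive (near _ _ H1 x Ux) _.
have H2 x : U x -> derive1n 2 H x = cst 0 x.
  by move=> /dH1[_]; rewrite /derive1n/= derive1E.
move=> x Ux; split.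
- by case: (dH x Ux).
- by case: (dH1 x Ux).
- have c0 : cst (0 : R) y @[y --> x] --> derive1n 2 H x.
    by rewrite (H2 x Ux); exact: cvg_cst.
  exact: cvg_trans (near_eq_cvg (near _ _ H2 x Ux)) c0.
- exact: H2.
Qed.

(** The open set U is ]- s, 2 - s[, on which the remainder is affine. *)
Lemma phi_test_mapping : test_mapping (@acoef R) (@phi R).
Proof.
move=> s; rewrite /Omega/= in_itv/= => /[dup] s01 /andP[s0 s1]; split.
  by rewrite /acoef mul1r invr_neq0// mulf_neq0// gt_eqF// subr_gt0.
exists (fun x => phi s x - acoef s * Gamma s x); split.
  by move=> x; rewrite addrC subrK.
exists `]- s, 2 - s[%classic.
have oU : open (`]- s, 2 - s[%classic : set R) by exact: interval_open.
have aff x : `]- s, 2 - s[%classic x -> phi s x - acoef s * Gamma s x =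
    ((1 - s) / (2 * s) - s / (2 * (1 - s))) * x +
    ((1 - s) / 2 + (2 - s) * s / (2 * (1 - s))).
  by rewrite /= in_itv/= => xs; rewrite phi_affine// addrC addKr.
have reg := affine_regular oU aff.
split; first exact: oU.
- by move=> x; rewrite /= !in_itv/=; lra.
- by move=> x /reg[].
- by move=> x /reg[].
Qed.

End Hat.

Theorem theorem4p1 (R : realType) (f u : R -> R) (hf : Lq 1 f)
    (hu : weak_dirichlet_solution f u) :
  [/\ test_mapping (@acoef R) (@phi R),
      globally_green_representable f u (@acoef R) (@phi R) &
      forall s : R, Omega s ->
        acoef s * u s = intO (fun x => f x * phi s x)].
Proof.
have fi := Lq1_integrableO hf.
have [Hu _] := hu; have [u0 u1] := H10_boundary Hu; have [Hu1 _] := Hu.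
have [c uc] := dirichlet_derivative fi hu.
have Fi := prim_integrable fi.
(* u 0 = 0 fixes the constant of integration and u 1 = 0 fixes c *)
have E x : 0 <= x <= 1 -> u x = c * x - prim (prim f) x.
  move=> /[dup] x01 /andP[x0 x1]; rewrite (H1_prim Hu1 x01) u0 add0r.
  rewrite -(@ae_eq_prim _ (fun x => c - prim f x)) ?primB ?prim_cst//.
  - exact: integrableO_cst.
  - by apply: integrableOB => //; exact: integrableO_cst.
  - exact: integrableO_measurable (H1_wderiv_integrableO Hu1).
  - by apply: ae_imply uc => y /[apply].
have cE : c = prim (prim f) 1.
  by have := E 1; rewrite u1 ler01 lexx => /(_ isT); rewrite mulr1; lra.
have main s : Omega s -> acoef s * u s = intO (fun x => f x * phi s x).
  rewrite /Omega/= in_itv/= => /[dup] s01 /andP[s0 s1].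
  rewrite E ?ltW// intO_phi// -cE /acoef.
  by field; rewrite ?gt_eqF ?subr_gt0//; lra.
split; [exact: phi_test_mapping| |exact: main].
split; first exact: phi_test_mapping.
  by exists 2; [rewrite ltr1n|].
exists (fun psi => (c - prim f 1) * psi 1 - c * psi 0).
  move=> psi v Hv vpsi; rewrite -(vpsi 0) -?(vpsi 1); [|by right|by left].
  by rewrite (dirichlet_green fi Hu1 Hv uc).
move=> s Os; rewrite main// -[LHS]addr0; congr (_ + _).
move: Os; rewrite /Omega/= in_itv/= => s01.
have -> : phi s 0 = 0.
  rewrite phi_hat// ?lexx ?ler01//; move: s01 => /andP[s0 s1].
  by rewrite min_l ?ltW// !mulr0 subrr.
have -> : phi s 1 = 0.
  rewrite phi_hat// ?lexx ?ler01//; move: s01 => /andP[s0 s1].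
  rewrite min_r ?ltW// /acoef; field; rewrite ?gt_eqF ?subr_gt0//; lra.
by rewrite !mulr0 subrr.
Qed.
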